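(* Let $W$ be a complete discrete valuation ring with finite residue field of cardinality $q$, let $d\ge1$, and let $(A,B)$ be a random pair of monic polynomials of degree $d$ over $W$ distributed according to the Haar probability measure. For $j\in\{0,\dots,d-1\}$ let $V_j$ be the valuation of the $j$-th principal subresultant of $(A,B)$, $W_j$ the minimum of the valuations of the coefficients of the $j$-th subresultant $\mathrm{Res}_j(A,B)$, and $\delta_j=V_j-W_j$. Then for all $j\in\{0,\dots,d-1\}$ and all $m\in\mathbb N$, $$\mathbb P[\delta_j\ge m]\ge \frac{(q-1)(q^j-1)}{q^{j+1}-1}\,q^{-m}.$$
   Context: The set of pairs of monic degree-$d$ polynomials over $W$ is identified with $W^{2d}$ via the non-leading coefficients, with the product Haar probability measure. The $j$-th subresultant $\mathrm{Res}_j(A,B)$ (computed in degree $(d,d)$) is the polynomial of degree $\le j$ whose coefficient of $X^k$ ($0\le k\le j$) is the determinant of the square matrix of size $2(d-j)$ whose columns are the coefficient vectors of $X^{d-j-1}A,\dots,A,X^{d-j-1}B,\dots,B$ restricted to the monomials $X^{2d-j-1},\dots,X^{j+1},X^k$; its coefficient of $X^j$ is the $j$-th principal subresultant. Valuations of $0$ are $+\infty$. *)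

(* Defs.v *)
From HB Require Import structures.
From mathcomp Require Import all_boot all_order all_algebra.
From mathcomp Require Import all_classical all_reals all_analysis.

Set Implicit Arguments.
Unset Strict Implicit.
Unset Printing Implicit Defensive.

Import Order.TTheory GRing.Theory Num.Theory.

Local Open Scope classical_set_scope.
Local Open Scope ring_scope.

(* [idealr_closed] includes properness, and every subset of [W] is classically
   of the form [I : {pred W}].                                               *)
Definition nonzero_prime_ideal (W : idomainType) (I : {pred W}) : Prop :=
  [/\ idealr_closed I, prime_idealr_closed I & exists2 x, x \in I & x != 0].

(* A discrete valuation ring is a principal ideal domain with exactly one
   nonzero prime ideal. The improper ideal, generated by [1], need not be
   covered by [dvr_principal].                                               *)
HB.mixin Record isDVR W of GRing.IntegralDomain W := {
  dvr_principal : forall I : {pred W}, idealr_closed I ->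
    exists a : W, forall x, x \in I <-> exists y, x = y * a;
  dvr_prime_ideal : exists I : {pred W}, nonzero_prime_ideal I;
  dvr_prime_ideal_unique : forall I J : {pred W},
    nonzero_prime_ideal I -> nonzero_prime_ideal J -> I =i J
}.

#[short(type="dvrType")]
HB.structure Definition DVR := {W of GRing.IntegralDomain W & isDVR W}.

Section dvr.
Variable W : dvrType.

Definition maxideal : W -> bool := sval (cid (@dvr_prime_ideal W)).

Lemma maxidealP : nonzero_prime_ideal maxideal.
Proof. exact: svalP (cid (@dvr_prime_ideal W)). Qed.

Lemma maxideal_idealr_closed : idealr_closed maxideal.
Proof. by case: maxidealP. Qed.

HB.instance Definition _ := isIdealr.Build W maxideal maxideal_idealr_closed.

Definition residue_field : comNzRingType := {ideal_quot (maxideal : idealr W)}.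

(* The ideal generated by the [n]-fold products of elements of [maxideal];
   the coefficients [c] are needed for [n = 0].                              *)
Definition maxideal_pow (n : nat) : set W :=
  [set x | exists (k : nat) (c : 'I_k -> W) (f : 'I_k -> 'I_n -> W),
     (forall i l, f i l \in maxideal) /\
     x = \sum_(i < k) c i * \prod_(l < n) f i l].

Definition adic_open : set (set W) :=
  [set U | forall x, U x -> exists n, forall y, maxideal_pow n (y - x) -> U y].

Definition adic_cauchy (u : nat -> W) : Prop :=
  forall n, exists N, forall i j, (N <= i)%N -> (N <= j)%N ->
    maxideal_pow n (u i - u j).

Definition adic_cvg (u : nat -> W) (l : W) : Prop :=
  forall n, exists N, forall i, (N <= i)%N -> maxideal_pow n (u i - l).

Definition adic_complete : Prop :=
  forall u, adic_cauchy u -> exists l, adic_cvg u l.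

(* The normalised valuation; it is [+oo] at [0]. *)
Definition valuation (R : realType) (x : W) : \bar R :=
  ereal_sup [set (n%:R)%:E | n in [set n : nat | maxideal_pow n x]].

End dvr.

Arguments residue_field : clear implicits.
Arguments adic_complete : clear implicits.
Arguments valuation {W} R x.

Definition pointed_dvr (W : dvrType) : Type := W.
HB.instance Definition _ (W : dvrType) := Choice.on (pointed_dvr W).
HB.instance Definition _ (W : dvrType) :=
  isPointed.Build (pointed_dvr W) (0 : W).

(* [W] with the Borel sigma-algebra of its adic topology *)
Definition borel_dvr (W : dvrType) :=
  g_sigma_algebraType (@adic_open W : set (set (pointed_dvr W))).
HB.instance Definition _ (W : dvrType) := Measurable.on (borel_dvr W).

Definition is_haar (W : dvrType) (R : realType)
    (mu : probability (borel_dvr W) R) : Prop :=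
  forall (x : W) (E : set (borel_dvr W)), measurable E ->
    mu [set (x + (y : W) : W) | y in E] = mu E.

Section power_probability.
Context d (T : measurableType d) (R : realType).

Definition tuple_cons n (x : T * n.-tuple T) : n.+1.-tuple T :=
  [tuple of x.1 :: x.2].

Lemma measurable_tuple_cons n : measurable_fun [set: T * n.-tuple T]
  (@tuple_cons n).
Proof. exact: measurable_cons. Qed.

HB.instance Definition _ n := isMeasurableFun.Build _ _ _ _ (@tuple_cons n)
  (@measurable_tuple_cons n).

(* the [n]-fold product of [mu] *)
Fixpoint power_probability (mu : probability T R) (n : nat) :
    probability (n.-tuple T) R :=
  match n with
  | 0 => dirac ([tuple] : 0.-tuple T)
  | n'.+1 => distribution (mu \x power_probability mu n')%E (@tuple_cons n')
  end.

End power_probability.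

(* The monic polynomial of degree [d] whose coefficient of ['X^i] is the
   [i]-th entry of [t], for [i < d].                                         *)
Definition monic_of (W : nzRingType) (d : nat) (t : d.-tuple W) : {poly W} :=
  'X^d + Poly t.

Section subresultant.
Variables (W : comNzRingType) (d j : nat) (A B : {poly W}).

(* The columns are ['X^(d-j-1) A, ..., A, 'X^(d-j-1) B, ..., B] and the rows
   are indexed by ['X^(2d-j-1), ..., 'X^(j+1), 'X^k].                        *)
Definition subresultant_mx (k : nat) : 'M[W]_(2 * (d - j)) :=
  \matrix_(r, c)
    (if (c < d - j)%N then 'X^((d - j).-1 - c) * A
     else 'X^((2 * (d - j)).-1 - c) * B)
    `_(if (r < (2 * (d - j)).-1)%N then (2 * d - j).-1 - r else k)%N.

Definition subresultant : {poly W} :=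
  \poly_(k < j.+1) \det (subresultant_mx k).

Definition principal_subresultant : W := subresultant`_j.

End subresultant.

Section valuations.
Variables (W : dvrType) (R : realType) (d j : nat).
Variables (A B : {poly W}).
Local Open Scope ereal_scope.

Definition subresultant_V : \bar R := valuation R (principal_subresultant d j A B).

Definition subresultant_W : \bar R :=
  \big[mine/+oo]_(k < j.+1) valuation R (subresultant d j A B)`_k.

(* Here [+oo - +oo = -oo], so a pair with [subresultant d j A B = 0] is not
   counted in the event [m <= subresultant_delta].                                       *)
Definition subresultant_delta : \bar R := subresultant_V - subresultant_W.

End valuations.

Arguments subresultant_delta {W} R d j A B.

(* Main.v *)
Require Import Defs.
From HB Require Import structures.
From mathcomp Require Import all_boot all_order all_algebra.
From mathcomp Require Import all_classical all_reals all_analysis.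
From mathcomp Require Import zify ring.

                                                                            
                                                                              
                                                                               
                                                                               
                                                                                
                                                                              
                                                                                
                                                                              
                                                                               
                                                                             
                                                                        
                                                       

Import Order.TTheory GRing.Theory Num.Theory.
Import numFieldNormedType.Exports.

Local Open Scope classical_set_scope.
Local Open Scope ring_scope.

Set Implicit Arguments.
Unset Strict Implicit.
Unset Printing Implicit Defensive.

                                            

Section monic_deg.
Variable R : nzRingType.
Implicit Types (P Q : {poly R}) (k m n : nat).

Definition monic_deg n P : bool := (P \is monic) && (size P == n.+1).

Lemma monic_degE n P : monic_deg n P = (size P <= n.+1)%N && (P`_n == 1).
Proof.
apply/andP/andP => [[/monicP mP /eqP sP]|[sP /eqP Pn]].
  by rewrite sP leqnn -mP lead_coefE sP.
have sE : size P = n.+1.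
  apply/eqP; rewrite eqn_leq sP ltnNge; apply/negP => /leq_sizeP.
  by move=> /(_ n (leqnn n)); rewrite Pn; apply/eqP/oner_neq0.
by rewrite monicE lead_coefE sE /= Pn !eqxx.
Qed.

Lemma monic_deg_monic n P : monic_deg n P -> P \is monic.
Proof. by case/andP. Qed.

Lemma monic_deg_size n P : monic_deg n P -> size P = n.+1.
Proof. by case/andP => _ /eqP. Qed.

Lemma monic_deg_coef n P : monic_deg n P -> P`_n = 1.
Proof. by rewrite monic_degE => /andP[_ /eqP]. Qed.

Lemma monic_degXn n : monic_deg n ('X^n : {poly R}).
Proof. by rewrite /monic_deg monicXn size_polyXn /=. Qed.

Lemma monic_deg0 P : monic_deg 0 P -> P = 1.
Proof.
rewrite monic_degE => /andP[/size1_polyC {2}-> /eqP ->].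
by rewrite polyC1.
Qed.

Lemma size_polyD_leq k P Q :
  (size P <= k)%N -> (size Q <= k)%N -> (size (P + Q)%R <= k)%N.
Proof.
by move=> sP sQ; rewrite (leq_trans (size_polyD _ _)) ?geq_max ?sP.
Qed.

Lemma size_polyB_leq k P Q :
  (size P <= k)%N -> (size Q <= k)%N -> (size (P - Q)%R <= k)%N.
Proof. by move=> sP sQ; rewrite size_polyD_leq ?size_polyN. Qed.

Lemma size_polyM_leq m n k P Q : (m + n <= k.+1)%N ->
  (size P <= m)%N -> (size Q <= n)%N -> (size (P * Q)%R <= k)%N.
Proof.
move=> mnk sP sQ; apply: leq_trans (size_polyMleq _ _) _.
by rewrite -subn1 leq_subLR add1n (leq_trans (leq_add sP sQ)).
Qed.

Lemma monic_degD n P Q :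
  monic_deg n P -> (size Q <= n)%N -> monic_deg n (P + Q).
Proof.
rewrite !monic_degE => /andP[sP /eqP Pn] sQ.
by rewrite size_polyD_leq ?(leqW sQ) // coefD Pn (nth_default _ sQ) addr0 /=.
Qed.

Lemma size_monic_degB n P Q :
  monic_deg n P -> monic_deg n Q -> (size (P - Q)%R <= n)%N.
Proof.
move=> mP mQ; apply/leq_sizeP => i; rewrite coefB leq_eqVlt => /predU1P[<-|ni].
  by rewrite !monic_deg_coef // subrr.
by rewrite !nth_default ?subrr ?(monic_deg_size mP) ?(monic_deg_size mQ).
Qed.

Lemma monic_degM m n P Q :
  monic_deg m P -> monic_deg n Q -> monic_deg (m + n) (P * Q).
Proof.
case/andP=> mP /eqP sP /andP[mQ /eqP sQ]; rewrite /monic_deg monicMl // mQ.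
by rewrite size_monicM ?monic_neq0 // sP sQ addSn addnS /= eqxx.
Qed.

Lemma size_monic_degMl_leq n k P Q :
  monic_deg n P -> (size (P * Q)%R <= n + k)%N = (size Q <= k)%N.
Proof.
case/andP=> mP /eqP sP; have [->|Q0] := eqVneq Q 0.
  by rewrite mulr0 size_poly0.
by rewrite size_monicM // sP addSn /= leq_add2l.
Qed.

Lemma monic_degMl_cancel n k P Q :
  monic_deg n P -> monic_deg (n + k) (P * Q) -> monic_deg k Q.
Proof.
move=> nP mPQ; have [/andP[mP _] /andP[mM /eqP sM]] := (nP, mPQ).
have mQ : Q \is monic by rewrite -(monicMl Q mP).
have sQ : (size Q <= k.+1)%N.
  by rewrite -(size_monic_degMl_leq _ _ nP) sM addnS.
rewrite /monic_deg mQ eqn_leq sQ ltnNge -(size_monic_degMl_leq _ _ nP) sM.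
by rewrite ltnn.
Qed.

End monic_deg.

Lemma monic_deg_rdivp (R : comNzRingType) m n (P Q : {poly R}) :
  monic_deg m P -> monic_deg n Q -> (n <= m)%N -> exists q r : {poly R},
  [/\ P = q * Q + r, monic_deg (m - n) q & (size r <= n)%N].
Proof.
move=> mP nQ nm; have mQ := monic_deg_monic nQ.
pose q := Pdiv.Ring.rdivp P Q; pose r := Pdiv.Ring.rmodp P Q.
have PE : P = q * Q + r := Pdiv.RingMonic.rdivp_eq mQ P.
have sr : (size r <= n)%N.
  by rewrite -ltnS -(monic_deg_size nQ) Pdiv.Ring.ltn_rmodpN0 // monic_neq0.
exists q, r; split=> //; apply: (monic_degMl_cancel nQ).
have -> : Q * q = P - r by rewrite PE addrK mulrC.
by rewrite subnKC // monic_degD // size_polyN (leq_trans sr).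
Qed.

                                             

Section cofactors.
Variable R : comNzRingType.
Implicit Types A B C : {poly R}.

Record cofactors : Type := Cofactors
  { curA : {poly R}; curB : {poly R}; nextA : {poly R}; nextB : {poly R} }.

HB.instance Definition _ := gen_eqMixin cofactors.
HB.instance Definition _ := gen_choiceMixin cofactors.

Implicit Type M : cofactors.

Definition cur_rem M A B : {poly R} := curA M * A + curB M * B.

Definition next_rem M A B : {poly R} := nextA M * A + nextB M * B.

Definition initial_cofactors : cofactors := Cofactors 1 0 (-1) 1.

Definition euclid_at d n A B M : Prop :=
  [/\ (n <= d)%N, (size (curB M) <= d - n)%N, monic_deg (d - n) (nextB M),
      monic_deg n (cur_rem M A B) & (size (next_rem M A B) <= n)%N].

End cofactors.

Arguments initial_cofactors {R}.

Section euclid.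
Variables (R : comNzRingType) (d : nat) (A B : {poly R}).
Hypothesis mA : monic_deg d A.
Implicit Types (C P Q : {poly R}) (M : cofactors R) (n : nat).

                                                                        
                               
Lemma euclid_at_det n M : euclid_at d n A B M ->
  curA M * nextB M - nextA M * curB M = 1.
Proof.
case=> nd sV mV' mT sS; apply: monic_deg0; apply: (monic_degMl_cancel mA).
have -> : A * (curA M * nextB M - nextA M * curB M) =
    cur_rem M A B * nextB M - next_rem M A B * curB M.
  by rewrite /cur_rem /next_rem; ring.
rewrite addn0 monic_degD //; first by rewrite -(subnKC nd) monic_degM.
by rewrite size_polyN; apply: size_polyM_leq sS sV; rewrite subnKC.
Qed.

                                                                         
                                                                             
                   
Lemma euclid_at_eq0 n M P Q : euclid_at d n A B M ->
  (size Q <= d - n)%N -> (size (P * A + Q * B)%R <= n)%N -> P = 0 /\ Q = 0.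
Proof.
move=> E sQ sPQ; have := euclid_at_det E; move: E => [nd + _ mT _].
rewrite {}/cur_rem in mT *; case: M mT => U V U' V' /= mT sV det1.
have next0 : U * Q - V * P = 0.
  apply/eqP; rewrite -size_poly_leq0 -(size_monic_degMl_leq _ _ mA) addn0.
  have -> : A * (U * Q - V * P) = (U * A + V * B) * Q - (P * A + Q * B) * V.
    by ring.
  apply: size_polyB_leq; last by apply: size_polyM_leq sPQ sV; lia.
  by apply: size_polyM_leq (eq_leq (monic_deg_size mT)) sQ; lia.
have PE : P = (P * V' - Q * U') * U.
  by rewrite -[LHS]mulr1 -det1 -[RHS]addr0 -(mul0r U') -next0; ring.
have QE : Q = (P * V' - Q * U') * V.
  by rewrite -[LHS]mulr1 -det1 -[RHS]addr0 -(mul0r V') -next0; ring.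
have cur0 : P * V' - Q * U' = 0.
  apply/eqP; rewrite -size_poly_leq0 -(size_monic_degMl_leq _ _ mT) addn0.
  by rewrite mulrC mulrDr !mulrA -PE -QE.
by split; [rewrite PE | rewrite QE]; rewrite cur0 mul0r.
Qed.

Lemma euclid_at_unique n M M' :
  euclid_at d n A B M -> euclid_at d n A B M' -> M' = M.
Proof.
move=> E [_]; have eq0 P Q := euclid_at_eq0 (P := P) (Q := Q) E.
move: E => [nd].
rewrite /cur_rem /next_rem; case: M eq0 => U V U' V'; case: M' => P Q P' Q' /=.
move=> eq0 sV mV' mT sS sQ mQ' mT' sS'.
have [||/eqP + /eqP] := eq0 (P - U) (Q - V).
- exact: size_polyB_leq.
- by rewrite !mulrBl addrACA -opprD size_monic_degB.
rewrite !subr_eq0 => /eqP -> /eqP ->.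
have [||/eqP + /eqP] := eq0 (P' - U') (Q' - V').
- exact: size_monic_degB.
- by rewrite !mulrBl addrACA -opprD size_polyB_leq.
by rewrite !subr_eq0 => /eqP -> /eqP ->.
Qed.

Hypothesis mB : monic_deg d B.

Lemma euclid_at_initial : euclid_at d d A B initial_cofactors.
Proof.
split; rewrite /cur_rem /next_rem /= ?subnn //.
- by rewrite size_poly0.
- exact: (monic_degXn _ 0).
- by rewrite mul1r mul0r addr0.
- by rewrite mulN1r mul1r addrC size_monic_degB.
Qed.

Lemma size_euclid_curA n M :
  euclid_at d n A B M -> (size (curA M) <= (d - n).+1)%N.
Proof.
case=> nd sV _ mT _; rewrite -(size_monic_degMl_leq _ _ mA) mulrC.
rewrite -[_ * A](addrK (curB M * B)) size_polyB_leq //.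
  by rewrite -/(cur_rem M A B) (monic_deg_size mT); lia.
by apply: size_polyM_leq sV (eq_leq (monic_deg_size mB)); lia.
Qed.

Lemma size_euclid_nextA n M :
  euclid_at d n A B M -> (size (nextA M) <= (d - n).+1)%N.
Proof.
case=> nd _ mV' _ sS; rewrite -(size_monic_degMl_leq _ _ mA) mulrC.
rewrite -[_ * A](addrK (nextB M * B)) size_polyB_leq //.
  by rewrite -/(next_rem M A B) (leq_trans sS) //; lia.
apply: size_polyM_leq (eq_leq (monic_deg_size mV')) _; last first.
  exact: eq_leq (monic_deg_size mB).
lia.
Qed.

Section translation.
Variables (n : nat) (M : cofactors R) (C : {poly R}).
Hypotheses (E : euclid_at d n A B M) (sC : (size C <= n)%N).
Let A' := A - C * curB M.
Let B' := B + C * curA M.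

Lemma next_rem_translate : next_rem M A' B' = next_rem M A B + C.
Proof.
rewrite /A' /B' /next_rem -[in RHS](mulr1 C) -(euclid_at_det E); ring.
Qed.

Lemma monic_deg_translateA : monic_deg d A'.
Proof.
case: E => nd sV _ _ _; rewrite monic_degD // size_polyN.
by apply: size_polyM_leq sC sV; rewrite subnKC.
Qed.

Lemma monic_deg_translateB : monic_deg d B'.
Proof.
have sU := size_euclid_curA E; case: E => nd _ _ _ _; rewrite monic_degD //.
by apply: size_polyM_leq sC sU; rewrite addnS subnKC.
Qed.

Lemma euclid_at_translate : euclid_at d n A' B' M.
Proof.
case: (E) => nd sV mV' mT sS; split=> //.
  suff -> : cur_rem M A' B' = cur_rem M A B by [].
  by rewrite /A' /B' /cur_rem; ring.
by rewrite next_rem_translate size_polyD_leq.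
Qed.

End translation.
End euclid.

Lemma euclid_at_step (R : comUnitRingType) d n (A B : {poly R}) M :
  euclid_at d n A B M -> next_rem M A B != 0 ->
  lead_coef (next_rem M A B) \is a GRing.unit ->
  exists M', euclid_at d (size (next_rem M A B)).-1 A B M'.
Proof.
case=> nd sV mV' mT sS; set T := cur_rem M A B in mT *.
set S := next_rem M A B in sS * => S0 lU.
set i := (size S).-1; have iE : size S = i.+1.
  by rewrite prednK ?size_poly_gt0.
have lt_in : (i < n)%N by rewrite -iE.
pose c := (lead_coef S)^-1.
have mS : monic_deg i (c *: S).
  rewrite monic_degE -iE size_scale_leq coefZ -lead_coefE.
  by rewrite mulVr /=.
have [q [r [TE mq sr]]] := monic_deg_rdivp mT mS (ltnW lt_in).
exists (Cofactors (c *: nextA M) (c *: nextB M)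
  (q * nextA M - lead_coef S *: curA M) (q * nextB M - lead_coef S *: curB M)).
split=> /=; first by lia.
- by rewrite (leq_trans (size_scale_leq _ _)) // (monic_deg_size mV'); lia.
- have -> : (d - i = (n - i) + (d - n))%N by lia.
  rewrite monic_degD ?monic_degM // size_polyN.
  by rewrite (leq_trans (size_scale_leq _ _)) // (leq_trans sV) ?leq_addl.
- by rewrite /cur_rem /= -!scalerAl -scalerDr.
rewrite (_ : next_rem _ A B = lead_coef S *: - r).
  by apply: leq_trans (size_scale_leq _ _) _; rewrite size_polyN.
have -> : - r = q * (c *: S) - T by rewrite TE; ring.
rewrite scalerBr -scalerAr scalerA mulrV // scale1r -!mul_polyC /T /S.
by rewrite /cur_rem /next_rem /=; ring.
Qed.

                                                                    

Section determinants.
Variable R : comNzRingType.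

Lemma det_mul_entry n (M : 'M[R]_n) (v : 'cV[R]_n) c :
  \det M * v c 0 = \sum_r cofactor M r c * (M *m v) r 0.
Proof.
have := congr1 (fun w : 'cV[R]_n => w c 0) (mulmxA (\adj M) M v).
rewrite mul_adj_mx mul_scalar_mx !mxE => <-.
by apply: eq_bigr => r _; rewrite mxE.
Qed.

Lemma eq_det m n (M : 'M[R]_m) (N : 'M[R]_n) : m = n ->
  (forall (i j : 'I_m) (i' j' : 'I_n),
     i = i' :> nat -> j = j' :> nat -> M i j = N i' j') ->
  \det M = \det N.
Proof.
move=> mn; case: n / mn N => N MN.
by congr (\det _); apply/matrixP => i j; apply: MN.
Qed.

End determinants.

Section sylvester.
Variables (R : comNzRingType) (d : nat) (A B : {poly R}).
Implicit Types (P Q : {poly R}) (e j k n r : nat).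

Definition cofactor_col e P Q : 'cV[R]_(2 * e) :=
  \col_l (if (l < e)%N then P`_(e.-1 - l) else Q`_((2 * e).-1 - l)).

Lemma cofactor_col_surj e (v : 'cV[R]_(2 * e)) : exists P Q : {poly R},
  [/\ (size P <= e)%N, (size Q <= e)%N & v = cofactor_col e P Q].
Proof.
pose c i := (rVpoly v^T)`_i.
exists (\poly_(i < e) c (e.-1 - i)%N), (\poly_(i < e) c ((2 * e).-1 - i)%N).
split; rewrite ?size_poly //; apply/matrixP => l z.
have -> : v l z = c l by rewrite /c coef_rVpoly_ord mxE ord1.
rewrite mxE !coef_poly; have l2e := ltn_ord l.
case: (ltnP l e) => le; rewrite ifT; try lia.
all: by congr c; lia.
Qed.

Lemma sum_rev_coef_poly e P (C : {poly R}) : (size P <= e)%N ->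
  \sum_(l < e) P`_(e.-1 - l) *: ('X^(e.-1 - l) * C) = P * C.
Proof.
move=> sP; rewrite (reindex_inj rev_ord_inj) /=.
rewrite -[in RHS](take_poly_id sP) /take_poly poly_def mulr_suml.
apply: eq_bigr => i _; rewrite scalerAl.
by have -> : (e.-1 - (e - i.+1))%N = i by have := ltn_ord i; lia.
Qed.

Definition subresultant_row_degree j k r : nat :=
  if (r < (2 * (d - j)).-1)%N then ((2 * d - j).-1 - r)%N else k.

Lemma mul_subresultant_mx j k P Q :
  (size P <= d - j)%N -> (size Q <= d - j)%N ->
  subresultant_mx d j A B k *m cofactor_col (d - j) P Q =
  \col_r (P * A + Q * B)`_(subresultant_row_degree j k r).
Proof.
move=> sP sQ; apply/matrixP => r z; rewrite [LHS]mxE [RHS]mxE.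
under eq_bigr do rewrite [subresultant_mx _ _ _ _ _ _ _]mxE
  [cofactor_col _ _ _ _ _]mxE -/(subresultant_row_degree j k r).
move: (subresultant_row_degree j k r) => x; set e := (d - j)%N in sP sQ *.
rewrite -(sum_rev_coef_poly A sP) -(sum_rev_coef_poly B sQ).
rewrite coefD !coef_sum mul2n -addnn big_split_ord /=.
congr (_ + _); apply: eq_bigr => l _; rewrite coefZ mulrC.
  by rewrite ltn_ord.
rewrite ltnNge leq_addr /=.
by have -> : ((e + e).-1 - (e + l) = e.-1 - l)%N by lia.
Qed.

Lemma principal_subresultantE n :
  principal_subresultant d n A B = \det (subresultant_mx d n A B n).
Proof. by rewrite /principal_subresultant /subresultant coef_poly ltnSn. Qed.

Lemma mul_principal_subresultant_mx n P Q x (xd : (n <= x < 2 * d - n)%N) :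
  (size P <= d - n)%N -> (size Q <= d - n)%N ->
  exists r : 'I_(2 * (d - n)),
    (subresultant_mx d n A B n *m cofactor_col (d - n) P Q) r 0 =
    (P * A + Q * B)`_x /\ subresultant_row_degree n n r = x.
Proof.
move=> sP sQ; have xr : ((2 * d - n).-1 - x < 2 * (d - n))%N by lia.
have rowE : subresultant_row_degree n n ((2 * d - n).-1 - x) = x.
  by rewrite /subresultant_row_degree; case: ifP; lia.
by exists (Ordinal xr); rewrite mul_subresultant_mx // mxE rowE.
Qed.

Lemma principal_subresultant_solve n y (t : nat -> R) :
  principal_subresultant d n A B * y = 1 -> exists P Q : {poly R},
  [/\ (size P <= d - n)%N, (size Q <= d - n)%N &
      forall x, (n <= x < 2 * d - n)%N -> (P * A + Q * B)`_x = t x].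
Proof.
rewrite principal_subresultantE; set X := subresultant_mx _ _ _ _ _ => Xy.
have [P [Q [sP sQ PQ]]] := cofactor_col_surj
  (y *: (\adj X *m \col_r t (subresultant_row_degree n n r))).
exists P, Q; split=> // x xd.
have [r [<- rE]] := mul_principal_subresultant_mx xd sP sQ.
rewrite -PQ -scalemxAr mulmxA mul_mx_adj mul_scalar_mx scalerA mulrC Xy scale1r.
by rewrite mxE rE.
Qed.

Hypotheses (mA : monic_deg d A) (mB : monic_deg d B).

Lemma size_cofactor_combination n P Q : (n <= d)%N ->
  (size P <= d - n)%N -> (size Q <= d - n)%N ->
  (size (P * A + Q * B)%R <= 2 * d - n)%N.
Proof.
move=> nd sP sQ; apply: size_polyD_leq.
- by apply: size_polyM_leq sP (eq_leq (monic_deg_size mA)); lia.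
- by apply: size_polyM_leq sQ (eq_leq (monic_deg_size mB)); lia.
Qed.

                                                                           
                                                                            
                                                    
Lemma principal_subresultant_euclid_at n y : (n <= d)%N ->
  principal_subresultant d n A B * y = 1 -> exists M, euclid_at d n A B M.
Proof.
move=> nd Xy; pose D := 'X^(d - n) * (B - A).
have sD : (size D <= 2 * d - n)%N.
  apply: size_polyM_leq (eq_leq (size_polyXn _ _)) (size_monic_degB mB mA).
  by lia.
have [U [V [sU sV UV]]] :=
  principal_subresultant_solve (fun x => (x == n)%:R) Xy.
have [P [Q [sP sQ PQ]]] := principal_subresultant_solve (fun x => - D`_x) Xy.
have [dn|nd'] := leqP d n.
  have -> : n = d by apply/eqP; rewrite eqn_leq nd.
  by exists initial_cofactors; apply: euclid_at_initial.
exists (Cofactors U V (P - 'X^(d - n)) (Q + 'X^(d - n))); split=> //=.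
- by rewrite addrC monic_degD ?monic_degXn.
- rewrite /cur_rem monic_degE /= UV ?eqxx; last by lia.
  rewrite andbT; apply/leq_sizeP => x nx; have [xd|xd] := ltnP x (2 * d - n).
    by rewrite UV ?gtn_eqF //; lia.
  by rewrite nth_default // (leq_trans (size_cofactor_combination nd sU sV)).
have -> : next_rem (Cofactors U V (P - 'X^(d - n)) (Q + 'X^(d - n))) A B =
    P * A + Q * B + D by rewrite /next_rem /D /=; ring.
apply/leq_sizeP => x nx; rewrite coefD; have [xd|xd] := ltnP x (2 * d - n).
  by rewrite PQ ?addNr //; lia.
rewrite !nth_default ?addr0 // ?(leq_trans sD) //.
by rewrite (leq_trans (size_cofactor_combination nd sP sQ)).
Qed.

Lemma cofactor_subresultant_mx j k (r c : 'I_(2 * (d - j))) : (j < d)%N ->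
  r = (2 * (d - j)).-1 :> nat -> c = (d - j)%N :> nat ->
  cofactor (subresultant_mx d j A B k) r c =
  (-1) ^+ (d - j.+1) * principal_subresultant d j.+1 A B.
Proof.
move=> jd rE cE; rewrite /cofactor principal_subresultantE.
congr (_ * _).
  by rewrite -signr_odd -[RHS]signr_odd; congr (_ ^+ nat_of_bool _); lia.
have e0 : (0 < (2 * (d - j)).-1)%N by lia.
set N := row' r _; pose i0 := Ordinal e0.
                                                                       
have N0 i : N i0 i = (i == i0)%:R.
  rewrite !mxE /= rE cE /bump (leqNgt _ 0) e0 /= add0n e0 subn0.
  have ir := ltn_ord i; have [ie|ei] := ltnP i (d - j).
    have mXA l := monic_degM (monic_degXn R ((d - j).-1 - l)) mA.
    rewrite /= add0n ie; have [->|ii0] := eqVneq i i0.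
      by rewrite -[RHS](monic_deg_coef (mXA 0%N)) /=; congr (_`_ _); lia.
    rewrite nth_default // (monic_deg_size (mXA i)).
    by move: ii0; rewrite -val_eqE /=; lia.
  rewrite ifF; last by lia.
  rewrite nth_default; first by rewrite -val_eqE /=; case: eqP => //; lia.
  apply: size_polyM_leq (eq_leq (size_polyXn _ _)) (eq_leq (monic_deg_size mB)).
  by lia.
rewrite (expand_det_row N i0) (bigD1 i0) //= big1 => [|i ni]; last first.
  by rewrite N0 (negPf ni) mul0r.
rewrite N0 eqxx mul1r addr0 /cofactor /= expr0 mul1r.
apply: eq_det => [|i l i' l' ii' ll']; first by lia.
have := ltn_ord i'; have := ltn_ord l' => l'd i'd.
rewrite !mxE /= /bump rE cE ii' ll' /= !add1n.
have -> : (if (i' < (2 * (d - j.+1)).-1)%N then (2 * d - j.+1).-1 - i'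
           else j.+1)%N = ((2 * d - j.+1).-1 - i')%N by case: ifP; lia.
rewrite [X in _`_X]ifT; last by lia.
congr (_`_ _); last by lia.
have [l'e|l'e] := ltnP l' (d - j.+1).
  by rewrite ifT; [congr ('X^_ * _); lia | lia].
by rewrite ifF; [congr ('X^_ * _); lia | lia].
Qed.

                                                                       
                                                                 
Lemma subresultant_cofactors j P Q : (j < d)%N ->
  (size P <= d - j)%N -> (size Q <= d - j)%N ->
  (size (P * A + Q * B)%R <= j.+1)%N ->
  Q`_(d - j.+1) *: subresultant d j A B =
  ((-1) ^+ (d - j.+1) * principal_subresultant d j.+1 A B) *: (P * A + Q * B).
Proof.
move=> jd sP sQ sS; apply/polyP => k; rewrite !coefZ coef_poly ltnS.
case: leqP => [kj|jk]; last first.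
  by rewrite (nth_default _ (leq_trans sS jk)) !mulr0.
have rlt : ((2 * (d - j)).-1 < 2 * (d - j))%N by lia.
have clt : (d - j < 2 * (d - j))%N by lia.
have := det_mul_entry (subresultant_mx d j A B k) (cofactor_col (d - j) P Q)
  (Ordinal clt).
rewrite mul_subresultant_mx // (bigD1 (Ordinal rlt)) //= big1 => [|r rl].
  rewrite (cofactor_subresultant_mx _ _ _ (r := Ordinal rlt)) //.
  rewrite addr0 !mxE /subresultant_row_degree /= !ltnn mulrC => <-.
  by congr (Q`_ _ * _); lia.
have r2 := ltn_ord r; rewrite !mxE /subresultant_row_degree.
rewrite ifT ?nth_default ?mulr0 //.
  by rewrite (leq_trans sS) //; move: rl; rewrite -val_eqE /=; lia.
by move: rl; rewrite -val_eqE /=; lia.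
Qed.

Lemma subresultant_next_rem j M : euclid_at d j.+1 A B M ->
  subresultant d j A B =
  ((-1) ^+ (d - j.+1) * principal_subresultant d j.+1 A B) *: next_rem M A B.
Proof.
move=> E; have sU' := size_euclid_nextA mA mB E; case: E => jd _ mV' _ sS.
rewrite /next_rem -subresultant_cofactors //.
- by rewrite (monic_deg_coef mV') scale1r.
- by rewrite (leq_trans sU') //; lia.
- by rewrite (monic_deg_size mV'); lia.
Qed.

End sylvester.

Lemma mulmx_inj_det (R : finComNzRingType) n (X : 'M[R]_n) :
  (forall v : 'cV_n, X *m v = 0 -> v = 0) -> exists y, \det X * y = 1.
Proof.
move=> X0; have X_inj : injective (fun v : 'cV_n => X *m v).
  move=> u v uv; apply/eqP.
  by rewrite -subr_eq0 (X0 (u - v)) // mulmxBr uv subrr.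
have [g _ gK] := injF_bij X_inj.
exists (\det (\matrix_(i, k) g (col k 1%:M) i 0)); rewrite -det_mulmx.
rewrite (_ : X *m _ = 1%:M) ?det1 //; apply/matrixP => i k.
transitivity ((X *m g (col k 1%:M)) i 0); last by rewrite gK mxE.
by rewrite !mxE; apply: eq_bigr => l _; rewrite mxE.
Qed.

Lemma euclid_at_principal_subresultant (R : finComNzRingType) d n
    (A B : {poly R}) M :
  monic_deg d A -> monic_deg d B -> euclid_at d n A B M ->
  exists y, principal_subresultant d n A B * y = 1.
Proof.
move=> mA mB E; have [nd _ _ _ _] := E; rewrite principal_subresultantE.
apply: mulmx_inj_det => v.
have [P [Q [sP sQ ->]]] := cofactor_col_surj v => PQ0.
have [-> ->] : P = 0 /\ Q = 0.
  apply: (euclid_at_eq0 mA E sQ); apply/leq_sizeP => x nx.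
  have [xd|xd] := ltnP x (2 * d - n).
    have nxd : (n <= x < 2 * d - n)%N by rewrite nx.
    have [r [<- _]] := mul_principal_subresultant_mx A B nxd sP sQ.
    by rewrite PQ0 mxE.
  rewrite nth_default //.
  exact: leq_trans (size_cofactor_combination mA mB nd sP sQ) xd.
by apply/matrixP => l z; rewrite !mxE !coef0 if_same.
Qed.

Lemma map_subresultant (R S : comNzRingType) (f : {rmorphism R -> S}) d j
    (A B : {poly R}) :
  subresultant d j (map_poly f A) (map_poly f B) =
  map_poly f (subresultant d j A B).
Proof.
apply/polyP => k; rewrite coef_map !coef_poly; case: ltnP => [_|_].
  rewrite -[RHS](det_map_mx f); congr (\det _); apply/matrixP => r c.
  by rewrite !mxE -coef_map; case: ifP => _; rewrite rmorphM /= map_polyXn.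
exact: esym (rmorph0 f).
Qed.

                                                      

Section monic_of.
Variables (R : nzRingType) (d : nat).
Implicit Types (t : d.-tuple R) (P : {poly R}).

Lemma monic_deg_monic_of t : monic_deg d (monic_of t).
Proof.
by rewrite monic_degD ?monic_degXn // (leq_trans (size_Poly _)) ?size_tuple.
Qed.

Lemma coef_monic_of t (i : 'I_d) : (monic_of t)`_i = tnth t i.
Proof. by rewrite coefD coefXn ltn_eqF // add0r coef_Poly (tnth_nth 0). Qed.

Lemma monic_of_inj : injective (@monic_of R d).
Proof.
by move=> t u tu; apply: eq_from_tnth => i; rewrite -!coef_monic_of tu.
Qed.

Definition lower_coefs P : d.-tuple R := [tuple P`_i | i < d].

Lemma lower_coefsK P : monic_deg d P -> monic_of (lower_coefs P) = P.
Proof.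
move=> mP; apply/polyP => i; have [id|di|->] := ltngtP i d.
- by rewrite (coef_monic_of _ (Ordinal id)) tnth_mktuple.
- by rewrite !nth_default ?(monic_deg_size mP)
    ?(monic_deg_size (monic_deg_monic_of _)).
- by rewrite (monic_deg_coef mP) (monic_deg_coef (monic_deg_monic_of _)).
Qed.

End monic_of.

Lemma map_monic_of (R S : nzRingType) (f : {rmorphism R -> S}) d
    (t : d.-tuple R) :
  map_poly f (monic_of t) = monic_of (map_tuple f t).
Proof.
rewrite /monic_of rmorphD /= map_polyXn; congr (_ + _).
apply/polyP => i; rewrite coef_map !coef_Poly /=.
have [it|ti] := ltnP i (size t); first by rewrite (nth_map 0).
by rewrite !nth_default ?size_map // rmorph0.
Qed.

Section pairs.
Variables (R : comNzRingType) (d : nat).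
Local Notation pairs := (d.-tuple R * d.-tuple R)%type.
Implicit Types (ab : pairs) (n : nat) (M : cofactors R) (C : {poly R}).

Definition pair_euclid_at n ab M : Prop :=
  euclid_at d n (monic_of ab.1) (monic_of ab.2) M.

Definition pair_next_rem M ab : {poly R} :=
  next_rem M (monic_of ab.1) (monic_of ab.2).

Lemma pair_euclid_at_unique n ab M M' :
  pair_euclid_at n ab M -> pair_euclid_at n ab M' -> M' = M.
Proof. exact: (euclid_at_unique (monic_deg_monic_of _)). Qed.

Lemma pair_euclid_at_initial ab : pair_euclid_at d ab initial_cofactors.
Proof. by apply: euclid_at_initial; apply: monic_deg_monic_of. Qed.

Definition pair_cofactors n ab : cofactors R :=
  xget initial_cofactors [set M | pair_euclid_at n ab M].

Lemma pair_cofactorsE n ab M : pair_euclid_at n ab M -> pair_cofactors n ab = M.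
Proof.
by move=> E; apply: xget_unique => // M'; apply: pair_euclid_at_unique.
Qed.

Definition translate_pair M C ab : pairs :=
  (lower_coefs d (monic_of ab.1 - C * curB M),
   lower_coefs d (monic_of ab.2 + C * curA M)).

Section translate_pair.
Variables (n : nat) (M : cofactors R) (C : {poly R}).
Hypothesis sC : (size C <= n)%N.

Lemma monic_of_translate_pair ab : pair_euclid_at n ab M ->
  monic_of (translate_pair M C ab).1 = monic_of ab.1 - C * curB M /\
  monic_of (translate_pair M C ab).2 = monic_of ab.2 + C * curA M.
Proof.
have [mA mB] := (monic_deg_monic_of ab.1, monic_deg_monic_of ab.2).
move=> E; split; apply: lower_coefsK.
- exact: (monic_deg_translateA mA E sC).
- exact: (monic_deg_translateB mA mB E sC).
Qed.

Lemma pair_euclid_at_translate ab : pair_euclid_at n ab M ->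
  pair_euclid_at n (translate_pair M C ab) M.
Proof.
move=> E; rewrite /pair_euclid_at.
have [-> ->] := monic_of_translate_pair E.
exact: (euclid_at_translate (monic_deg_monic_of _) E sC).
Qed.

Lemma pair_next_rem_translate ab : pair_euclid_at n ab M ->
  pair_next_rem M (translate_pair M C ab) = pair_next_rem M ab + C.
Proof.
move=> E; rewrite /pair_next_rem.
have [-> ->] := monic_of_translate_pair E.
exact: (next_rem_translate (monic_deg_monic_of _) C E).
Qed.

Lemma translate_pair_inj ab ab' :
  pair_euclid_at n ab M -> pair_euclid_at n ab' M ->
  translate_pair M C ab = translate_pair M C ab' -> ab = ab'.
Proof.
move=> /monic_of_translate_pair[a b] /monic_of_translate_pair[a' b'] tE.
move: a b; rewrite tE a' b' => /addIr/monic_of_inj a /addIr/monic_of_inj b.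
by rewrite [ab]surjective_pairing [ab']surjective_pairing a b.
Qed.

End translate_pair.
End pairs.

Section subresultant_pair.
Variables (R : comNzRingType) (d : nat).
Implicit Types (ab : d.-tuple R * d.-tuple R) (j n : nat).

Definition pair_principal n ab : R :=
  principal_subresultant d n (monic_of ab.1) (monic_of ab.2).

Definition subresultant_rV j ab : 'rV[R]_j.+1 :=
  poly_rV (subresultant d j (monic_of ab.1) (monic_of ab.2)).

End subresultant_pair.

Section map_pair.
Variables (R S : comNzRingType) (f : {rmorphism R -> S}) (d : nat).
Implicit Types (ab : d.-tuple R * d.-tuple R) (j n : nat).

Definition map_pair ab : d.-tuple S * d.-tuple S :=
  (map_tuple f ab.1, map_tuple f ab.2).

Lemma pair_principal_map n ab :
  pair_principal n (map_pair ab) = f (pair_principal n ab).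
Proof.
rewrite /pair_principal /principal_subresultant /= -!map_monic_of.
by rewrite map_subresultant coef_map.
Qed.

Lemma subresultant_rV_map j ab :
  subresultant_rV j (map_pair ab) = map_mx f (subresultant_rV j ab).
Proof.
by rewrite /subresultant_rV /= -!map_monic_of map_subresultant map_poly_rV.
Qed.

End map_pair.

Section equidistribution.
Variables (R : finComNzRingType) (d n : nat).
Local Notation pairs := (d.-tuple R * d.-tuple R)%type.
Implicit Types (ab : pairs) (Y : {set 'rV[R]_n}).

Definition euclid_good : {set pairs} :=
  [set ab | `[< exists M, pair_euclid_at n ab M >]].

Definition next_rem_row ab : 'rV[R]_n :=
  poly_rV (pair_next_rem (pair_cofactors n ab) ab).

Lemma euclid_goodP ab :
  reflect (pair_euclid_at n ab (pair_cofactors n ab)) (ab \in euclid_good).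
Proof.
rewrite inE; apply: (iffP (asboolP _)) => [[M E]|]; last by eexists; eauto.
by rewrite (pair_cofactorsE E).
Qed.

Lemma euclid_good_principalP ab : (n <= d)%N ->
  ab \in euclid_good <-> exists y, pair_principal n ab * y = 1.
Proof.
have [mA mB] := (monic_deg_monic_of ab.1, monic_deg_monic_of ab.2).
move=> nd; split=> [/euclid_goodP|[y ny]].
  exact: euclid_at_principal_subresultant mA mB.
have [M E] := principal_subresultant_euclid_at mA mB nd ny.
by apply/euclid_goodP; rewrite (pair_cofactorsE E).
Qed.

Definition next_rem_fiber (c : 'rV[R]_n) : {set pairs} :=
  [set ab in euclid_good | next_rem_row ab == c].

Lemma next_rem_fiberP c ab :
  reflect (pair_euclid_at n ab (pair_cofactors n ab) /\ next_rem_row ab = c)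
          (ab \in next_rem_fiber c).
Proof.
rewrite [_ \in next_rem_fiber _]inE.
by apply: (iffP andP) => -[E rE]; split; apply/euclid_goodP || apply/eqP.
Qed.

Lemma leq_card_next_rem_fiber c c' :
  (#|next_rem_fiber c| <= #|next_rem_fiber c'|)%N.
Proof.
pose C := rVpoly (c' - c); have sC : (size C <= n)%N by apply: size_poly.
pose f ab := translate_pair (pair_cofactors n ab) C ab.
have fE ab : ab \in next_rem_fiber c ->
    pair_cofactors n (f ab) = pair_cofactors n ab.
  move=> /next_rem_fiberP[E _].
  by apply: pair_cofactorsE; apply: (pair_euclid_at_translate sC E).
rewrite -(card_in_imset (f := f)) => [|ab ab' abc abc' fab]; last first.
  have M_eq : pair_cofactors n ab = pair_cofactors n ab'.
    by rewrite -fE // fab fE.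
  move: abc abc' fab => /next_rem_fiberP[E _] /next_rem_fiberP[E' _].
  rewrite /f -M_eq in E' *.
  exact: (translate_pair_inj sC E E').
apply/subset_leq_card/fintype.subsetP => _ /imsetP[ab abc ->].
have M_eq := fE _ abc; move: abc => /next_rem_fiberP[E rE].
apply/next_rem_fiberP; split.
  by rewrite M_eq; apply: (pair_euclid_at_translate sC E).
rewrite /next_rem_row M_eq (pair_next_rem_translate sC E) linearD /=.
by rewrite -/(next_rem_row ab) rE rVpolyK subrKC.
Qed.

Lemma card_euclid_good_next_rem Y :
  #|[set ab in euclid_good | next_rem_row ab \in Y]| =
  (#|Y| * #|next_rem_fiber 0|)%N.
Proof.
rewrite -sum1_card (partition_big next_rem_row (mem Y)) /=; last first.
  by move=> ab; rewrite inE => /andP[].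
rewrite -sum_nat_const; apply: eq_bigr => c cY; rewrite sum1_card.
transitivity #|next_rem_fiber c|; last first.
  by apply/eqP; rewrite eqn_leq !leq_card_next_rem_fiber.
apply: eq_card => ab; rewrite [RHS]inE unfold_in /= [X in X && _]inE -andbA.
congr (_ && _).
by have [->|] := eqVneq (next_rem_row ab) c; rewrite ?andbF ?cY.
Qed.

Lemma next_rem_equidistributed Y :
  (#|[set ab in euclid_good | next_rem_row ab \in Y]| * #|{: 'rV[R]_n}| =
   #|euclid_good| * #|Y|)%N.
Proof.
have -> : #|euclid_good| =
    #|[set ab in euclid_good | next_rem_row ab \in [set: 'rV[R]_n]%SET]|.
  apply: eq_card => ab; apply/idP/finset.setIdP => [good|[]//].
  by split=> //; apply: finset.in_setT.
by rewrite !card_euclid_good_next_rem cardsT mulnC [in LHS](mulnC #|Y|) mulnA.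
Qed.

End equidistribution.

Lemma subresultant_rV_next_rem (R : finComNzRingType) d j
    (ab : d.-tuple R * d.-tuple R) : ab \in euclid_good R d j.+1 ->
  exists u y, y * u = 1 /\ subresultant_rV j ab = u *: next_rem_row j.+1 ab.
Proof.
have [mA mB] := (monic_deg_monic_of ab.1, monic_deg_monic_of ab.2).
move=> /euclid_goodP E; have [y ny] := euclid_at_principal_subresultant mA mB E.
pose sign : R := (-1) ^+ (d - j.+1).
exists (sign * pair_principal j.+1 ab), (sign * y); split.
  by rewrite mulrACA -expr2 sqrr_sign mul1r mulrC.
by rewrite /subresultant_rV (subresultant_next_rem mA mB E) linearZ.
Qed.

Section last_step_above.
Variables (R : comNzRingType) (d n : nat).
Local Notation pairs := (d.-tuple R * d.-tuple R)%type.
Implicit Types (ab : pairs) (M : cofactors R) (k l : nat).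

                                                                        
                                       
Definition is_last_step_above ab k M : Prop :=
  [/\ (n < k)%N, pair_euclid_at k ab M & (size (pair_next_rem M ab) <= n.+1)%N].

Lemma is_last_step_above_leq ab k M l M' :
  is_last_step_above ab k M -> is_last_step_above ab l M' -> (l <= k)%N.
Proof.
move=> [nk E _] [_ [ld _ mV' _ _] sS]; rewrite leqNgt; apply/negP => kl.
have sV' : (size (nextB M') <= d - k)%N.
  by rewrite (monic_deg_size mV'); lia.
have [_ V'0] := euclid_at_eq0 (monic_deg_monic_of _) E sV' (leq_trans sS nk).
by move: (monic_deg_size mV'); rewrite V'0 size_poly0.
Qed.

Definition last_step_above ab : nat * cofactors R :=
  xget (0%N, initial_cofactors) [set kM | is_last_step_above ab kM.1 kM.2].

Lemma last_step_aboveE ab k M :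
  is_last_step_above ab k M -> last_step_above ab = (k, M).
Proof.
move=> kM; apply: xget_unique => // -[l M'] /= lM'.
have lk : l = k.
  by apply/eqP; rewrite eqn_leq (is_last_step_above_leq kM lM')
    (is_last_step_above_leq lM' kM).
case: kM lM' => _ E _; rewrite lk => -[_ E' _].
by rewrite (pair_euclid_at_unique E E').
Qed.

Lemma is_last_step_above_translate x ab k M : is_last_step_above ab k M ->
  is_last_step_above (translate_pair M (x *: 'X^n) ab) k M.
Proof.
move=> [nk E sS].
have sX : (size (x *: 'X^n)%R <= n.+1)%N.
  by rewrite (leq_trans (size_scale_leq _ _)) ?size_polyXn.
have sC := leq_trans sX nk.
split=> //; first exact: (pair_euclid_at_translate sC E).
by rewrite (pair_next_rem_translate sC E) size_polyD_leq.
Qed.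

End last_step_above.

Section bad_pairs.
Variables (F : finFieldType) (d n : nat).
Hypothesis nd : (n <= d)%N.
Local Notation pairs := (d.-tuple F * d.-tuple F)%type.
Implicit Types (ab : pairs) (x : F).

Lemma ex_last_step_above ab : ab \notin euclid_good F d n ->
  exists k M, is_last_step_above n ab k M /\ (size (pair_next_rem M ab) <= n)%N.
Proof.
have goodE k : (exists M, pair_euclid_at k ab M) -> ab \in euclid_good F d k.
  by move=> [M E]; apply/euclid_goodP; rewrite (pair_cofactorsE E).
move=> bad; have ex_k : exists k, (n < k)%N && (ab \in euclid_good F d k).
  exists d; have good_d : ab \in euclid_good F d d.
    by apply: goodE; exists initial_cofactors; apply: pair_euclid_at_initial.
  by rewrite good_d andbT ltn_neqAle nd andbT; apply: contraNneq bad => ->.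
have [k /andP[nk /euclid_goodP E] k_min] := ex_minnP ex_k.
set M := pair_cofactors k ab in E; exists k, M.
suff sS : (size (pair_next_rem M ab) <= n)%N by split=> //; split=> //; lia.
rewrite leqNgt; apply/negP => nS.
have S0 : pair_next_rem M ab != 0 by rewrite -size_poly_gt0; lia.
have lead_unit : lead_coef (pair_next_rem M ab) \is a GRing.unit.
  by rewrite unitfE lead_coef_eq0.
have := goodE _ (euclid_at_step E S0 lead_unit).
have : (size (pair_next_rem M ab) <= k)%N by case: E.
rewrite -/(pair_next_rem M ab); case: (size _) nS => // i ni ik good_i.
move: bad; have [<-|n_neq_i _] := eqVneq i n; first by rewrite good_i.
have := k_min i; rewrite good_i andbT; move: ni; rewrite ltnS leq_eqVlt.
by rewrite eq_sym (negPf n_neq_i) /= => -> /(_ isT); rewrite leqNgt ik.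
Qed.

                                                                          
                                                                            
                                      
Lemma card_not_euclid_good :
  (#|~: euclid_good F d n| * #|F| <= #|{: pairs}|)%N.
Proof.
pose f (abx : pairs * F) :=
  translate_pair (last_step_above n abx.1).2 (abx.2 *: 'X^n) abx.1.
have badP ab : ab \in ~: euclid_good F d n -> exists k M,
  [/\ last_step_above n ab = (k, M), is_last_step_above n ab k M
    & (size (pair_next_rem M ab) <= n)%N].
  rewrite inE => /ex_last_step_above[k [M [kM sS]]].
  by exists k, M; split=> //; apply: last_step_aboveE.
rewrite -[#|F|]cardsT -cardsX -(card_in_imset (f := f)) ?max_card //.
move=> [ab x] [ab' x'] /finset.setXP[/badP[k [M [kME kM sS]]] _].
move=> /finset.setXP[/badP[k' [M' [kME' kM' sS']]] _].
rewrite /f /= kME kME' /= => ff.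
have := last_step_aboveE (is_last_step_above_translate x kM).
rewrite ff (last_step_aboveE (is_last_step_above_translate x' kM')).
move=> [k_eq M_eq]; rewrite {}k_eq {}M_eq in kM' sS' ff *.
have [[nk E _] [_ E' _]] := (kM, kM').
have sC (y : F) : (size (y *: 'X^n)%R <= k)%N.
  by rewrite (leq_trans (size_scale_leq _ _)) ?size_polyXn.
have x_eq : x = x'.
  have := congr1 (fun ab => (pair_next_rem M ab)`_n) ff.
  rewrite !(pair_next_rem_translate (sC _)) // 2!coefD !coefZ !coefXn eqxx.
  rewrite !mulr1.
  by rewrite (nth_default _ sS) (nth_default _ sS') !add0r.
by rewrite x_eq in ff *; rewrite (translate_pair_inj (sC x') E E' ff).
Qed.

Lemma euclid_good_proportion_ge (K : realFieldType) :
  1 - #|F|%:R^-1 <= #|euclid_good F d n|%:R / #|{: pairs}|%:R :> K.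
Proof.
have F0 : 0 < #|F|%:R :> K by rewrite ltr0n ltnW ?card_finNzRing_gt1.
have pairs0 : 0 < #|{: pairs}|%:R :> K.
  by rewrite card_prod !card_tuple natrM natrX mulr_gt0 ?exprn_gt0.
rewrite ler_pdivlMr // mulrBl mul1r lerBlDr.
rewrite -{1}(cardsC (euclid_good F d n)) natrD lerD2l.
by rewrite ler_pdivlMl // -natrM ler_nat mulnC card_not_euclid_good.
Qed.

End bad_pairs.

                                                            

Section pow_ideal.
Variable R : comNzRingType.
Implicit Types (p x y u : R) (n : nat).

Definition pow_ideal p n : R -> bool :=
  fun x => `[< exists y, x = y * p ^+ n >].

Lemma pow_idealP p n x :
  reflect (exists y, x = y * p ^+ n) (x \in pow_ideal p n).
Proof. exact: asboolP. Qed.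

Lemma pow_ideal_zmod_closed p n : zmod_closed (pow_ideal p n).
Proof.
split=> [|x y /pow_idealP[u ->] /pow_idealP[v ->]]; apply/pow_idealP.
  by exists 0; rewrite mul0r.
by exists (u - v); rewrite mulrBl.
Qed.

HB.instance Definition _ p n :=
  GRing.isZmodClosed.Build R (pow_ideal p n) (pow_ideal_zmod_closed p n).

Lemma pow_idealMl p n x y : y \in pow_ideal p n -> x * y \in pow_ideal p n.
Proof.
by move=> /pow_idealP[u ->]; apply/pow_idealP; exists (x * u); rewrite mulrA.
Qed.

Lemma pow_ideal0 p x : x \in pow_ideal p 0.
Proof. by apply/pow_idealP; exists x; rewrite mulr1. Qed.

Lemma pow_ideal_leq p m n x :
  (m <= n)%N -> x \in pow_ideal p n -> x \in pow_ideal p m.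
Proof.
move=> mn /pow_idealP[y ->]; apply/pow_idealP.
by exists (y * p ^+ (n - m)); rewrite -mulrA -exprD subnK.
Qed.

Lemma pow_ideal_unit p n u v x : v * u = 1 ->
  (u * x \in pow_ideal p n) = (x \in pow_ideal p n).
Proof.
move=> vu; apply/idP/idP => [/(pow_idealMl v)|]; last exact: pow_idealMl.
by rewrite mulrA vu mul1r.
Qed.

End pow_ideal.

Section dvr.
Local Open Scope quotient_scope.
Local Open Scope ring_scope.
Variable W : dvrType.
Implicit Types (x y : W) (i k n : nat).

Lemma ex_uniformizer :
  exists a : W, forall x, x \in @maxideal W <-> exists y, x = y * a.
Proof. exact: (@dvr_principal W (@maxideal W) (@maxideal_idealr_closed W)). Qed.

Definition uniformizer : W := sval (cid ex_uniformizer).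
Local Notation pi := uniformizer.
Local Notation "''m^' n" := (pow_ideal pi n) (at level 8, n at level 2).

Lemma maxidealE x : (x \in @maxideal W) = (x \in 'm^1).
Proof.
apply/idP/pow_idealP; rewrite expr1 => x_in.
  exact: (svalP (cid ex_uniformizer) x).1.
exact: (svalP (cid ex_uniformizer) x).2.
Qed.

Lemma uniformizer_neq0 : pi != 0.
Proof.
have [_ _ [x]] := maxidealP W.
rewrite maxidealE => /pow_idealP[y ->]; rewrite expr1.
by apply: contraNneq => ->; rewrite mulr0.
Qed.

Lemma one_notin_maxideal_pow n : 1 \notin 'm^n.+1.
Proof.
apply/negP => /(@pow_ideal_leq _ _ 1 n.+1 _ isT); rewrite -maxidealE.
apply/negP.
by have [_ +] := maxideal_idealr_closed W.
Qed.

Lemma maxideal_powP n x : maxideal_pow n x <-> x \in 'm^n.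
Proof.
split=> [[k [c [f [fm ->]]]]|/pow_idealP[y ->]]; last first.
  exists 1%N, (fun=> y), (fun _ _ => pi); split.
    by move=> _ _; rewrite maxidealE; apply/pow_idealP; exists 1; rewrite mul1r.
  by rewrite big_ord1 prodr_const card_ord.
apply: rpred_sum => i _; apply: pow_idealMl.
have /choice[g fg] : forall l, exists y, f i l = y * pi ^+ 1.
  by move=> l; apply/pow_idealP; rewrite -maxidealE.
apply/pow_idealP; exists (\prod_l g l); rewrite (eq_bigr _ (fun l _ => fg l)).
by rewrite big_split /= prodr_const card_ord expr1.
Qed.

Lemma mul_maxideal_pow i n x : (i <= n)%N ->
  (pi ^+ i * x \in 'm^n) = (x \in 'm^(n - i)).
Proof.
move=> le_in; apply/pow_idealP/pow_idealP => -[y].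
  rewrite -{1}(subnKC le_in) exprD mulrCA => /mulfI ->; first by exists y.
  by rewrite expf_neq0 // uniformizer_neq0.
by move=> ->; exists y; rewrite mulrCA -exprD subnKC.
Qed.

                                                                   
Lemma maxideal_maximal x : x \notin 'm^1 -> exists y, 1 - y * x \in 'm^1.
Proof.
move=> nx; apply: contrapT => no_inv.
pose I : W -> bool := fun z => `[< exists a b, z = a * x + b * pi >].
have IP z : reflect (exists a b, z = a * x + b * pi) (z \in I).
  exact: asboolP.
have I_ideal : idealr_closed I.
  split=> [||a _ _ /IP[b [c ->]] /IP[b' [c' ->]]].
  - by apply/IP; exists 0, 0; rewrite !mul0r addr0.
  - apply/negP => /IP[a [b ab]]; apply: no_inv; exists a.
    by rewrite ab addrC addKr; apply/pow_idealP; exists b.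
  - by apply/IP; exists (a * b + b'), (a * c + c'); ring.
have [g gI] := dvr_principal I I_ideal.
have [v xE] : exists v, x = v * g.
  by apply/gI/IP; exists 1, 0; rewrite mul1r mul0r addr0.
have [u piE] : exists u, pi = u * g.
  by apply/gI/IP; exists 0, 1; rewrite mul1r mul0r add0r.
have [_ prime_m _] := maxidealP W.
have : u * g \in @maxideal W.
  by rewrite -piE maxidealE; apply/pow_idealP; exists 1; rewrite mul1r.
move=> /prime_m; rewrite !maxidealE => /orP[/pow_idealP[w uE]|]; last first.
  by move=> /(pow_idealMl v); rewrite -xE (negPf nx).
have gw : 1 = w * g.
  apply: (mulfI uniformizer_neq0); rewrite mulr1 {1}piE uE expr1; ring.
by have [_ /negP[]] := I_ideal; apply/gI; exists w.
Qed.

Lemma maxideal_pow_proper n : 1 \notin 'm^n.+1 /\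
  forall a, {in 'm^n.+1, forall x, a * x \in 'm^n.+1}.
Proof.
by split=> [|a x]; [exact: one_notin_maxideal_pow | exact: pow_idealMl].
Qed.

HB.instance Definition _ n :=
  isProperIdeal.Build W (pow_ideal uniformizer n.+1) (maxideal_pow_proper n).

Definition is_reduction n (S : nzRingType) (f : W -> S) : Prop :=
  (forall s, exists x, f x = s) /\ (forall x y, f x = f y <-> x - y \in 'm^n).

Section reduction.
Variables (n : nat) (S : comNzRingType) (f : {rmorphism W -> S}).
Hypothesis f_red : is_reduction n f.

Lemma reduction_pow_ideal i x : (i <= n)%N ->
  (f x \in pow_ideal (f pi) i) = (x \in 'm^i).
Proof.
move=> le_in; have [f_surj f_eq] := f_red.
apply/pow_idealP/pow_idealP => -[y]; last first.
  by move=> ->; exists (f y); rewrite rmorphM rmorphXn.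
have [z <-] := f_surj y; rewrite -rmorphXn -rmorphM => /f_eq xz.
apply/pow_idealP; rewrite -(subrK (z * pi ^+ i) x) rpredD //.
  exact: pow_ideal_leq xz.
by apply/pow_idealP; exists z.
Qed.

Lemma reduction_eq0 x : f x = 0 <-> x \in 'm^n.
Proof. by rewrite -(rmorph0 f) f_red.2 subr0. Qed.

                                                                            
Lemma reduction_invertible x : x \notin 'm^1 -> exists s, f x * s = 1.
Proof.
move=> /maxideal_maximal[y]; set z := 1 - y * x => /pow_idealP[u zE].
have [_ f_eq] := f_red; exists (f (y * \sum_(i < n) z ^+ i)).
rewrite -rmorphM -(rmorph1 f); apply/f_eq.
have -> : x * (y * \sum_(i < n) z ^+ i) = 1 - z ^+ n.
  by rewrite -opprB subrX1 {2}/z; move: (\sum_(i < n) _) => s; ring.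
rewrite addrC addKr.
by rewrite rpredN; apply/pow_idealP; exists (u ^+ n); rewrite zE exprMn expr1.
Qed.

End reduction.

Definition digit_system (q : nat) (D : 'I_q -> W) : Prop :=
  (forall x, exists a, x - D a \in 'm^1) /\
  (forall a b, D a - D b \in 'm^1 -> a = b).

Lemma ex_digit_system q : ([set: residue_field W] #= `I_q)%card ->
  exists D : 'I_q -> W, digit_system D.
Proof.
move=> /card_set_bijP[e [efun einj esurj]].
have piE x y : \pi_(residue_field W) x = \pi_(residue_field W) y <->
    x - y \in 'm^1.
  rewrite -maxidealE; split=> [/eqP|xy].
    by rewrite -[_ == _]Quotient.idealrBE.
  by apply/eqP; rewrite -[_ == _]Quotient.idealrBE.
have /choice[D DE] : forall a : 'I_q, exists w : W,
    e (\pi_(residue_field W) w) = a.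
  move=> a; have [s _ sE] := esurj a (ltn_ord a).
  by exists (repr s); rewrite reprK.
exists D; split=> [x|a b /piE ab].
  have lt_e : (e (\pi_(residue_field W) x) < q)%N by apply: efun.
  exists (Ordinal lt_e); apply/piE/einj; rewrite ?in_setT //.
by apply: val_inj; rewrite /= -!DE ab.
Qed.

Section digits.
Variables (q : nat) (D : 'I_q -> W).
Hypothesis D_digits : digit_system D.

Definition digit_sum (t : seq 'I_q) : W := foldr (fun a v => D a + pi * v) 0 t.

Lemma digit_sum_surj n x : exists t : n.-tuple 'I_q, x - digit_sum t \in 'm^n.
Proof.
elim: n x => [|n IHn] x; first by exists [tuple]; apply: pow_ideal0.
have [a /pow_idealP[y]] := D_digits.1 x; rewrite expr1 => xa.
have [t yt] := IHn y; exists [tuple of a :: t] => /=.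
by rewrite opprD addrA xa mulrC -mulrBr (@mul_maxideal_pow 1) // subn1.
Qed.

Lemma digit_sum_inj n (t u : n.-tuple 'I_q) :
  digit_sum t - digit_sum u \in 'm^n -> t = u.
Proof.
elim: n t u => [|n IHn] t u; first by rewrite (tuple0 t) (tuple0 u).
case: (tupleP t) => a {}t; case: (tupleP u) => b {}u /=.
rewrite opprD addrACA -mulrBr => tu.
have ab : a = b.
  apply: D_digits.2; rewrite -[_ - _](addrK (pi * (digit_sum t - digit_sum u))).
  rewrite rpredB //; first exact: pow_ideal_leq tu.
  by rewrite -[pi in pi * _]expr1 (@mul_maxideal_pow 1 1) // pow_ideal0.
by move: tu; rewrite ab subrr add0r (@mul_maxideal_pow 1) // subn1 => /IHn ->.
Qed.

Section card_reduction.
Variables (n : nat) (S : finComNzRingType) (f : {rmorphism W -> S}).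
Hypothesis f_red : is_reduction n f.

Lemma card_reduction_pow_ideal i : (i <= n)%N ->
  #|[set s : S | s \in pow_ideal (f pi) i]%SET| = (q ^ (n - i))%N.
Proof.
have [f_surj f_eq] := f_red; move=> le_in.
pose g (t : (n - i).-tuple 'I_q) : S := f (pi ^+ i * digit_sum t).
have g_inj : injective g.
  move=> t u /f_eq; rewrite -mulrBr mul_maxideal_pow //.
  exact: digit_sum_inj.
transitivity #|g @: [set: (n - i).-tuple 'I_q]%SET|; last first.
  by rewrite card_imset // cardsT card_tuple card_ord.
apply: eq_card => s; rewrite inE; have [x <-] := f_surj s.
rewrite (reduction_pow_ideal f_red) //; apply/idP/imsetP => [|[t _ /f_eq xt]].
  move=> /pow_idealP[y ->]; have [t yt] := digit_sum_surj (n - i) y.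
  exists t; rewrite ?finset.in_setT //; apply/f_eq.
  by rewrite mulrC -mulrBr mul_maxideal_pow.
rewrite -(subrK (pi ^+ i * digit_sum t) x) rpredD ?(pow_ideal_leq _ xt) //.
by apply/pow_idealP; exists (digit_sum t); rewrite mulrC.
Qed.

Lemma card_reduction : #|S| = (q ^ n)%N.
Proof.
rewrite -[n in RHS]subn0 -card_reduction_pow_ideal // -cardsT.
by apply: eq_card => s; rewrite !inE pow_ideal0.
Qed.

End card_reduction.

Lemma ex_reduction n : exists (S : finComNzRingType) (f : {rmorphism W -> S}),
  is_reduction n.+1 f.
Proof.
pose Q : comNzRingType := {ideal_quot (pow_ideal pi n.+1 : idealr W)}.
have pi_eq x y : \pi_Q x = \pi_Q y <-> x - y \in 'm^n.+1.
  by split=> [/eqP|xy]; [|apply/eqP]; rewrite -[_ == _]Quotient.idealrBE.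
pose g (t : n.+1.-tuple 'I_q) : Q := \pi_Q (digit_sum t).
have /choice[h hK] : forall s, exists t, g t = s.
  move=> s; have [t tE] := digit_sum_surj n.+1 (repr s).
  by exists t; rewrite -[s]reprK; apply/esym/pi_eq.
pose countable_Q := CanIsCountable hK.
pose C : countType := HB.pack (GRing.ComNzRing.sort Q) countable_Q.
pose finite_Q := @PCanIsFinite C _ h _ (can_pcan hK).
pose S : finComNzRingType :=
  HB.pack (GRing.ComNzRing.sort Q) countable_Q finite_Q.
exists S, (\pi_Q : {rmorphism W -> Q}); split; last exact: pi_eq.
by move=> s; exists (repr (s : Q)); apply: (reprK (s : Q)).
Qed.

Lemma ex_residue_reduction :
  exists (F : finFieldType) (f : {rmorphism W -> F}), is_reduction 1 f.
Proof.
have [S [f f_red]] := ex_reduction 0; have [f_surj _] := f_red.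
have /choice[inv invP] : forall s : S, exists t, s != 0 -> t * s = 1.
  move=> s; have [x <-] := f_surj s.
  have [|/(reduction_invertible f_red)[t xt]] := boolP (x \in 'm^1).
    by move=> /(reduction_eq0 f_red) ->; exists 0; rewrite eqxx.
  by exists t; rewrite mulrC.
pose res_inv s := if s == 0 then 0 else inv s.
have res_invP s : s != 0 -> res_inv s * s = 1.
  by rewrite /res_inv => s0; rewrite (negPf s0) invP.
have res_inv0 : res_inv 0 = 0 by rewrite /res_inv eqxx.
pose F : finFieldType := HB.pack (FinRing.ComNzRing.sort S)
  (GRing.ComNzRing_isField.Build S res_invP res_inv0).
by exists F, f.
Qed.

End digits.
End dvr.

                           

Lemma card_row_family (S : finType) n (A : 'I_n -> {set S}) :
  #|[set v : 'rV[S]_n | [forall i, v 0 i \in A i]]%SET| = (\prod_i #|A i|)%N.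
Proof.
pose row (g : {ffun 'I_n -> S}) : 'rV[S]_n := \row_i g i.
have row_inj : injective row.
  by move=> g h /rowP gh; apply/ffunP => i; have := gh i; rewrite !mxE.
transitivity #|(row @: [set g | g \in family A])%SET|.
  apply: eq_card => v; rewrite inE; apply/forallP/imsetP.
    move=> vA; exists [ffun i => v 0 i].
      by rewrite inE; apply/familyP => i; rewrite ffunE.
    by apply/rowP => i; rewrite mxE ffunE.
  by move=> [g]; rewrite inE => /familyP gA -> i; rewrite mxE.
by rewrite card_imset // cardsE card_family foldrE big_map big_enum.
Qed.

Section delta_level.
Variables (R : comNzRingType) (p : R) (j : nat).
Implicit Types (v : 'rV[R]_j.+1) (m n w : nat).

Definition row_in_pow_ideal n v : bool := [forall k, v 0 k \in pow_ideal p n].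

                                                                               
                                                                          
              
Definition delta_level m w v : bool :=
  [&& row_in_pow_ideal w v, ~~ row_in_pow_ideal w.+1 v
    & v 0 ord_max \in pow_ideal p (w + m)].

Lemma row_in_pow_ideal_leq n n' v :
  (n' <= n)%N -> row_in_pow_ideal n v -> row_in_pow_ideal n' v.
Proof.
by move=> nn' /forallP vn; apply/forallP => k; apply: pow_ideal_leq (vn k).
Qed.

Lemma delta_level_unique m w w' v :
  delta_level m w v -> delta_level m w' v -> w = w'.
Proof.
move=> /and3P[vw nvw _] /and3P[vw' nvw' _].
apply/eqP; rewrite eqn_leq; apply/andP; split; rewrite leqNgt; apply/negP => lt.
  by rewrite (row_in_pow_ideal_leq lt vw) in nvw'.
by rewrite (row_in_pow_ideal_leq lt vw') in nvw.
Qed.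

Lemma delta_level_unit m w u y v : y * u = 1 ->
  delta_level m w (u *: v) = delta_level m w v.
Proof.
move=> yu; have inE k n : ((u *: v) 0 k \in pow_ideal p n) =
    (v 0 k \in pow_ideal p n) by rewrite mxE (pow_ideal_unit _ _ _ yu).
have rowE n : row_in_pow_ideal n (u *: v) = row_in_pow_ideal n v.
  by apply: eq_forallb => k; apply: inE.
by rewrite /delta_level !rowE inE.
Qed.

End delta_level.

Definition level_rows (S : finComNzRingType) (p : S) (j m w : nat) :
    {set 'rV[S]_j.+1} :=
  [set v | delta_level p m w v].

Section delta_level_reduction.
Variables (W : dvrType) (j m w : nat).
Local Notation pi := (uniformizer W).

Lemma delta_level_reduction n (S : comNzRingType) (f : {rmorphism W -> S})
    (v : 'rV[W]_j.+1) : is_reduction n f -> (w + m < n)%N ->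
  delta_level (f pi) m w (map_mx f v) = delta_level pi m w v.
Proof.
move=> f_red wmn.
have rowE i : (i <= n)%N ->
    row_in_pow_ideal (f pi) i (map_mx f v) = row_in_pow_ideal pi i v.
  move=> i_n; apply: eq_forallb => k.
  by rewrite mxE (reduction_pow_ideal f_red).
by rewrite /delta_level !rowE ?mxE ?(reduction_pow_ideal f_red) //; lia.
Qed.

                                                                              
                                             
Lemma leq_card_level_rows (q : nat) (D : 'I_q -> W) (S : finComNzRingType)
    (f : {rmorphism W -> S}) :
  digit_system D -> is_reduction (w + m).+1 f ->
  (q ^ (m.+1 * j).+1 - q ^ (m * j).+1 <= #|level_rows (f pi) j m w|)%N.
Proof.
move=> D_digits f_red; set N := (w + m).+1 in f_red.
pose ideal i := [set s : S | s \in pow_ideal (f pi) i]%SET.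
pose A i (k : 'I_j.+1) := ideal (if (k < j)%N then i else w + m)%N.
pose box i := [set v : 'rV[S]_j.+1 | [forall k, v 0 k \in A i k]]%SET.
have card_box i : (i <= N)%N -> #|box i| = (q ^ ((N - i) * j).+1)%N.
  move=> iN; rewrite card_row_family big_ord_recr /= /A ltnn.
  rewrite (eq_bigr (fun=> q ^ (N - i))%N) => [|k _]; last first.
    by rewrite /= ltn_ord (card_reduction_pow_ideal D_digits f_red).
  rewrite prod_nat_const card_ord (card_reduction_pow_ideal D_digits f_red) //.
  by rewrite subSnn expn1 -expnM -expnSr.
have box_level : box w :\: box w.+1 \subset level_rows (f pi) j m w.
  apply/fintype.subsetP => v /finset.setDP[].
  rewrite !finset.in_set negb_forall => /forallP vA /existsP[k nk].
  have AE i l : (v 0 l \in A i l) =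
      (v 0 l \in pow_ideal (f pi) (if (l < j)%N then i else w + m)).
    by rewrite finset.in_set.
  have kj : (k < j)%N.
    by apply: contraNT nk => /negPf kj; have := vA k; rewrite /A kj.
  apply/and3P; split.
  - apply/forallP => l; have := vA l; rewrite AE; case: ifP => // _.
    by apply: pow_ideal_leq; rewrite leq_addr.
  - by apply: contra nk => /forallP/(_ k); rewrite AE kj.
  - by have := vA ord_max; rewrite AE /= ltnn.
apply: leq_trans (subset_leq_card box_level); rewrite cardsD leq_sub //.
  by rewrite card_box /N; [rewrite -addnS addKn | lia].
apply: leq_trans (subset_leq_card (finset.subsetIr _ _)) _.
by rewrite card_box /N; [rewrite subSS addKn | lia].
Qed.

End delta_level_reduction.

Section valuation.
Variables (W : dvrType) (R : realType) (j : nat).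
Local Notation pi := (uniformizer W).
Implicit Types (x : W) (v : 'rV[W]_j.+1) (m n w : nat).
Local Open Scope ereal_scope.

Lemma valuation_le n x : x \notin pow_ideal pi n.+1 -> valuation R x <= n%:R%:E.
Proof.
move=> nx; apply: ge_ereal_sup => _ [k /maxideal_powP xk <-].
rewrite lee_fin ler_nat leqNgt; apply: contra nx => nk.
exact: pow_ideal_leq nk xk.
Qed.

Lemma valuation_ge n x : (n%:R%:E <= valuation R x) = (x \in pow_ideal pi n).
Proof.
apply/idP/idP => [|/maxideal_powP xn]; last first.
  by apply: ereal_sup_ubound; exists n.
apply: contraTT => nx; case: n nx => [|n] nx; first by rewrite pow_ideal0 in nx.
by rewrite -ltNge (le_lt_trans (valuation_le nx)) // lte_fin ltr_nat.
Qed.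

Lemma valuation_nat_or_pinfty x :
  valuation R x = +oo \/ exists n, valuation R x = n%:R%:E.
Proof.
have [x_in|] := pselect (forall n, x \in pow_ideal pi n).
  left; apply/eqyP => A A0; have := x_in (Num.truncn A).+1.
  rewrite -valuation_ge; apply: le_trans; rewrite lee_fin ltW //.
  exact: truncnS_gt.
move=> /existsNP nx; right; have {}nx : exists n, x \notin pow_ideal pi n.
  by have [n /negP] := nx; exists n.
have [[|n] xn n_min] := ex_minnP nx; first by rewrite pow_ideal0 in xn.
exists n; apply/eqP; rewrite eq_le valuation_le //= valuation_ge.
by apply: contraT => /n_min; rewrite ltnn.
Qed.

Definition min_valuation v : \bar R :=
  \big[mine/+oo]_(k < j.+1) valuation R (v 0%R k).

Lemma min_valuation_ge n v :
  (n%:R%:E <= min_valuation v) = row_in_pow_ideal pi n v.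
Proof.
apply/bigmin_geP/forallP => [[_ vn] k|vn]; first by rewrite -valuation_ge vn.
by split=> [|k _]; rewrite ?leey // valuation_ge.
Qed.

Lemma min_valuation_nat_or_pinfty v :
  min_valuation v = +oo \/ exists n, min_valuation v = n%:R%:E.
Proof.
apply: (big_ind (fun a => a = +oo \/ exists n : nat, a = n%:R%:E))
  => [|a b|k _]; [by left| |exact: valuation_nat_or_pinfty].
by rewrite minElt; case: ifP.
Qed.

Lemma delta_ge_level m v :
  m%:R%:E <= valuation R (v 0%R ord_max) - min_valuation v <->
  exists w, delta_level pi m w v.
Proof.
have [vE|[n vE]] := min_valuation_nat_or_pinfty v.
  rewrite vE addeNy leeNy_eq; split=> // -[w /and3P[_ + _]].
  by rewrite -min_valuation_ge vE leey.
rewrite vE leeBrDr // -EFinD -natrD addnC valuation_ge.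
have rowE i : row_in_pow_ideal pi i v = (i <= n)%N.
  by rewrite -min_valuation_ge vE lee_fin ler_nat.
split=> [v_last|[w]]; first by exists n; rewrite /delta_level !rowE leqnn ltnn.
rewrite /delta_level !rowE => /and3P[wn nw].
by have -> : w = n by apply/eqP; rewrite eqn_leq wn leqNgt.
Qed.

End valuation.

                                                   

Section uniform_image.
Context (disp : measure_display) (T : measurableType disp) (R : realType).
Variable S : finType.
Implicit Types (f : T -> S) (E : {set S}).

Definition uniform_image (mu : {measure set T -> \bar R}) f : Prop :=
  forall s, measurable [set x | f x = s] /\
    mu [set x | f x = s] = (#|S|%:R^-1)%:E.

Lemma preimage_bigcup_fiber f E :
  [set x | f x \in E] = \bigcup_(s in [set` enum E]) [set x | f x = s].
Proof.
apply/seteqP; split=> [x /= fE|x [s /= + ->]]; last by rewrite mem_enum.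
by exists (f x) => //=; rewrite mem_enum.
Qed.

Lemma measurable_finite_preimage f E :
  (forall s, measurable [set x | f x = s]) -> measurable [set x | f x \in E].
Proof.
by move=> mf; rewrite preimage_bigcup_fiber; apply: fin_bigcup_measurable.
Qed.

Lemma measure_finite_preimage (mu : {measure set T -> \bar R}) f E (c : R) :
  (forall s, measurable [set x | f x = s]) ->
  (forall s, mu [set x | f x = s] = c%:E) ->
  mu [set x | f x \in E] = (#|E|%:R * c)%:E.
Proof.
move=> mf muf; rewrite preimage_bigcup_fiber measure_fin_bigcup //; last first.
  by move=> s t _ _ [x [/= <- <-]].
rewrite -fsbig_seq ?enum_uniq // (eq_bigr (fun=> c%:E)) => [|s _]; last first.
  exact: muf.
by rewrite big_enum /= sumEFin sumr_const mulr_natl.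
Qed.

Lemma uniform_image_preimage (mu : {measure set T -> \bar R}) f E :
  uniform_image mu f -> mu [set x | f x \in E] = (#|E|%:R / #|S|%:R)%:E.
Proof. by move=> uf; apply: measure_finite_preimage => s; case: (uf s). Qed.

Lemma uniform_image_probability (P : probability T R) f :
  (forall s, measurable [set x | f x = s]) ->
  (forall s t, P [set x | f x = s] = P [set x | f x = t]) -> uniform_image P f.
Proof.
move=> mf Pf s; split=> //; pose c := fine (P [set x | f x = s]).
have Pc t : P [set x | f x = t] = c%:E.
  by rewrite (Pf t s) fineK //; apply: fin_num_measure.
have : P [set: T] = (#|S|%:R * c)%:E.
  rewrite -cardsT -(measure_finite_preimage _ mf Pc); congr (P _).
  by apply/seteqP; split=> x //= _; rewrite finset.in_setT.
rewrite probability_setT => -[Sc]; apply: (etrans (Pc s)); congr EFin.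
have S0 : #|S|%:R != 0 :> R.
  by apply/eqP => S0; move: Sc; rewrite S0 mul0r; apply/eqP/oner_neq0.
by apply: (mulfI S0); rewrite -Sc divff.
Qed.

End uniform_image.

Section uniform_product.
Context (R : realType) (d1 d2 : measure_display).
Context (T1 : measurableType d1) (T2 : measurableType d2).
Variables (P1 : probability T1 R) (P2 : probability T2 R).
Variables (S1 S2 : finType) (f1 : T1 -> S1) (f2 : T2 -> S2).

Lemma uniform_image_pair : uniform_image P1 f1 -> uniform_image P2 f2 ->
  uniform_image (P1 \x P2)%E (fun x => (f1 x.1, f2 x.2)).
Proof.
move=> u1 u2 [s1 s2]; have [[mf1 Pf1] [mf2 Pf2]] := (u1 s1, u2 s2).
have -> : [set x | (f1 x.1, f2 x.2) = (s1, s2)] =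
    [set x | f1 x = s1] `*` [set x | f2 x = s2].
  by apply/seteqP; split=> -[x y] /= []-> ->.
split; first exact: measurableX.
apply: (etrans (product_measure1E _ _ mf1 mf2)).
rewrite [X in (X * _)%E]Pf1 [X in (_ * X)%E]Pf2 -EFinM.
by rewrite card_prod natrM invfM.
Qed.

End uniform_product.

Section uniform_tuple.
Context (disp : measure_display) (T : measurableType disp) (R : realType).
Variables (P : probability T R) (S : finType) (f : T -> S).

Lemma measurable_map_tuple_fiber n (s : n.-tuple S) :
  (forall a, measurable [set x | f x = a]) ->
  measurable [set t : n.-tuple T | map_tuple f t = s].
Proof.
move=> mf; rewrite (_ : [set t | _] = \bigcap_(i in [set: 'I_n])
    ((@tnth _ T)^~ i @^-1` [set x | f x = tnth s i])).
  apply: fin_bigcap_measurable => // i _; rewrite -[X in measurable X]setTI.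
  by apply: measurable_tnth => //; apply: mf.
apply/seteqP; split=> t /=; first by move=> <- i _ /=; rewrite tnth_map.
by move=> ts; apply: eq_from_tnth => i; rewrite tnth_map; apply: (ts i).
Qed.

Lemma uniform_image_tuple n :
  uniform_image P f ->
  uniform_image (power_probability P n) (map_tuple f (n:=n)).
Proof.
move=> uf; elim: n => [|n IHn] s.
  rewrite (_ : [set t | _] = setT); last first.
    by apply/seteqP; split=> // t _ /=; rewrite [LHS]tuple0 [RHS]tuple0.
  by split=> //; rewrite /= diracE in_setT card_tuple expn0 invr1.
case/tupleP: s => s t; have [_ Pst] := uniform_image_pair uf IHn (s, t).
split; first by apply: measurable_map_tuple_fiber => a; case: (uf a).
rewrite card_tuple expnS -card_tuple -card_prod -Pst.
rewrite /= /distribution /pushforward.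
congr (_ _); apply/seteqP; split=> -[x u] /=.
  by move=> /(congr1 val)[-> ut]; congr pair; apply: val_inj.
by move=> [<- <-]; apply: val_inj.
Qed.

End uniform_tuple.

Lemma haar_uniform_image (W : dvrType) (R : realType)
    (mu : probability (borel_dvr W) R) n (S : finComNzRingType)
    (f : {rmorphism W -> S}) :
  is_haar mu -> is_reduction n f -> uniform_image mu (f : borel_dvr W -> S).
Proof.
move=> mu_haar [f_surj f_eq].
have mf s : measurable ([set x | f x = s] : set (borel_dvr W)).
  apply: sub_sigma_algebra => x /= <-; exists n => y.
  by move=> /maxideal_powP/f_eq.
suff mu0 s : mu [set x | f x = s] = mu [set x | f x = 0].
  by apply: uniform_image_probability => // s t; rewrite !mu0.
have [x xs] := f_surj s.
rewrite -(mu_haar x _ (mf 0)); congr (mu _).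
apply/seteqP; split=> [y /= ys|_ [y /= y0 <-]]; last first.
  by rewrite rmorphD xs y0 addr0.
exists ((y : W) - x); last exact: subrKC.
by rewrite /= rmorphB ys xs subrr.
Qed.

                                      

Lemma level_proportion (F : fieldType) (Q : F) j m w : Q != 0 ->
  (Q ^+ (m.+1 * j).+1 - Q ^+ (m * j).+1) / (Q ^+ (w + m).+1) ^+ j.+1 =
  (1 - Q^-1 ^+ j) * Q^-1 ^+ m * (Q^-1 ^+ j.+1) ^+ w.
Proof.
move=> Q0; have -> : ((m.+1 * j).+1 = (m * j).+1 + j)%N by ring.
have w_exp : ((w + m).+1 * j.+1 = (m * j).+1 + j + m + j.+1 * w)%N by ring.
rewrite -exprM w_exp exprD [Q ^+ (_ + j.+1 * w)]exprD exprM 2!exprD !exprVn.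
by field; rewrite !expf_neq0.
Qed.

Lemma eseries_geometric (R : realType) (a r : R) : `|r| < 1 ->
  (\sum_(n <oo) (geometric a r n)%:E = (a / (1 - r))%:E)%E.
Proof.
move=> r1; have cvg_sum := @cvg_geometric_series _ a r r1.
rewrite -(cvg_lim _ cvg_sum) // -EFin_lim; last first.
  by apply/cvg_ex; exists (a / (1 - r)).
by congr (limn _); apply/funext => n; rewrite /= sumEFin.
Qed.

Section delta_distribution.
Variables (R : realType) (W : dvrType) (q : nat) (D : 'I_q -> W).
Hypothesis D_digits : digit_system D.
Variable mu : probability (borel_dvr W) R.
Hypothesis mu_haar : is_haar mu.
Variables (d j m : nat).
Hypothesis j_lt_d : (j < d)%N.

Local Notation pi := (uniformizer W).
Local Notation pairs := (d.-tuple (borel_dvr W) * d.-tuple (borel_dvr W))%type.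
Local Notation haar2 := (power_probability mu d \x power_probability mu d)%E.

Lemma uniform_image_map_pair n (S : finComNzRingType) (f : {rmorphism W -> S}) :
  is_reduction n f -> uniform_image haar2 (map_pair f (d:=d) : pairs -> _).
Proof.
move=> f_red; have uf := haar_uniform_image mu_haar f_red.
have ut := @uniform_image_tuple _ _ _ _ _ _ d uf.
exact: (uniform_image_pair ut ut).
Qed.

Lemma residue_card_gt1 : (1 < q)%N.
Proof.
have [F [f f_red]] := ex_residue_reduction D_digits.
by rewrite -[q]expn1 -(card_reduction D_digits f_red) card_finNzRing_gt1.
Qed.

Lemma residue_card_inv_le1 : q%:R^-1 <= 1 :> R.
Proof.
by rewrite invf_le1 ?ler1n ?ltr0n; apply: (leq_trans _ residue_card_gt1).
Qed.

Lemma euclid_good_lift n (S F : finComNzRingType) (f : {rmorphism W -> S})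
    (res : {rmorphism W -> F}) (ab : d.-tuple W * d.-tuple W) :
  is_reduction n f -> is_reduction 1 res ->
  map_pair res ab \in euclid_good F d j.+1 ->
  map_pair f ab \in euclid_good S d j.+1.
Proof.
move=> f_red res_red /(euclid_good_principalP _ j_lt_d)[y].
rewrite pair_principal_map => res_y; apply/(euclid_good_principalP _ j_lt_d).
rewrite pair_principal_map; apply: (reduction_invertible f_red).
apply/negP => /(reduction_eq0 res_red) res0.
by move: res_y; rewrite res0 mul0r => /esym/eqP; apply/negP/oner_neq0.
Qed.

Lemma haar2_euclid_good_ge n (S : finComNzRingType) (f : {rmorphism W -> S}) :
  is_reduction n f ->
  ((1 - q%:R^-1)%:E <= haar2 [set ab : pairs |
     map_pair f ab \in euclid_good S d j.+1])%E.
Proof.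
move=> f_red; have [F [res res_red]] := ex_residue_reduction D_digits.
have f_uniform := uniform_image_map_pair f_red.
have res_uniform := uniform_image_map_pair res_red.
apply: (@le_trans _ _ (haar2 [set ab : pairs |
    map_pair res ab \in euclid_good F d j.+1])); last first.
  apply: le_measure; rewrite ?inE.
  - by apply: measurable_finite_preimage => s; case: (res_uniform s).
  - by apply: measurable_finite_preimage => s; case: (f_uniform s).
  - by move=> ab; apply: (euclid_good_lift f_red res_red).
rewrite (uniform_image_preimage _ res_uniform) lee_fin.
have <- : #|F| = q by rewrite (card_reduction D_digits res_red) expn1.
exact: euclid_good_proportion_ge.
Qed.

Lemma subresultant_deltaE (ab : d.-tuple W * d.-tuple W) :
  subresultant_delta R d j (monic_of ab.1) (monic_of ab.2) =
  (valuation R (subresultant_rV j ab 0%R ord_max) -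
   min_valuation R (subresultant_rV j ab))%E.
Proof.
rewrite mxE; congr (_ - _)%E; apply: eq_bigr => k _.
by rewrite mxE.
Qed.

Definition delta_level_set w : set pairs :=
  [set ab | delta_level pi m w (subresultant_rV j (ab : d.-tuple W * _))].

Definition delta_level_pairs (S : finComNzRingType) (p : S) w :
    {set d.-tuple S * d.-tuple S} :=
  [set st | delta_level p m w (subresultant_rV j st)].

Lemma delta_level_setE n w (S : finComNzRingType) (f : {rmorphism W -> S}) :
  is_reduction n f -> (w + m < n)%N ->
  delta_level_set w =
  [set ab : pairs | map_pair f ab \in delta_level_pairs (f pi) w].
Proof.
move=> f_red wmn; apply/seteqP; split=> ab /=.
  by rewrite finset.in_set subresultant_rV_map (delta_level_reduction _ f_red).
by rewrite finset.in_set subresultant_rV_map (delta_level_reduction _ f_red).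
Qed.

Lemma measurable_delta_level_set w : measurable (delta_level_set w).
Proof.
have [S [f f_red]] := ex_reduction D_digits (w + m).
rewrite (delta_level_setE f_red) //; apply: measurable_finite_preimage => s.
by case: (uniform_image_map_pair f_red s).
Qed.

Lemma leq_card_delta_level_pairs (S : finComNzRingType) (p : S) w :
  (#|euclid_good S d j.+1| * #|level_rows p j m w| <=
   #|delta_level_pairs p w| * #|{: 'rV[S]_j.+1}|)%N.
Proof.
rewrite -next_rem_equidistributed leq_mul2r.
apply/orP; right; apply/subset_leq_card/fintype.subsetP => st.
move=> /finset.setIdP[/subresultant_rV_next_rem[u [y [yu sE]]]].
by rewrite !finset.in_set sE (delta_level_unit _ _ _ _ yu).
Qed.

Lemma haar2_delta_level_set_ge w :
  (((1 - q%:R^-1) * ((1 - q%:R^-1 ^+ j) * q%:R^-1 ^+ m) *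
     (q%:R^-1 ^+ j.+1) ^+ w)%:E <= haar2 (delta_level_set w))%E.
Proof.
have [S [f f_red]] := ex_reduction D_digits (w + m).
have f_uniform := uniform_image_map_pair f_red.
have := haar2_euclid_good_ge f_red.
rewrite (delta_level_setE f_red) // !(uniform_image_preimage _ f_uniform).
rewrite !lee_fin => G_ge.
have q0 : (0 < q)%N := ltnW residue_card_gt1.
have card_V : #|{: 'rV[S]_j.+1}| = ((q ^ (w + m).+1) ^ j.+1)%N.
  by rewrite card_mx mul1n (card_reduction D_digits f_red).
have V0 : 0 < #|{: 'rV[S]_j.+1}|%:R :> R by rewrite card_V ltr0n !expn_gt0 q0.
have Y_ge := leq_card_level_rows j D_digits f_red.
have := leq_card_delta_level_pairs (f pi) w.
move: Y_ge G_ge; set Y := #|_|; set N := (X in _ <= _ / X); set G := #|_|.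
move=> Y_ge G_ge; rewrite -(ler_nat R) !natrM => GY_le.
have Yw_ge : (1 - q%:R^-1 ^+ j) * q%:R^-1 ^+ m * (q%:R^-1 ^+ j.+1) ^+ w <=
    Y%:R / #|{: 'rV[S]_j.+1}|%:R :> R.
  rewrite -level_proportion ?pnatr_eq0 -?lt0n // {1}card_V !natrX.
  rewrite ler_wpM2r ?invr_ge0 ?ler0n // -!natrX lerBlDr -natrD ler_nat.
  by rewrite addnC -leq_subLR.
rewrite -mulrA; apply: (le_trans (ler_wpM2l _ Yw_ge)).
  by rewrite subr_ge0 residue_card_inv_le1.
apply: (le_trans (ler_wpM2r _ G_ge)); first by rewrite divr_ge0.
rewrite mulrACA -invfM [N * _]mulrC invfM mulrA ler_wpM2r ?invr_ge0 ?ler0n //.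
by rewrite ler_pdivrMr.
Qed.

Lemma haar2_delta_ge :
  ((((q%:R - 1) * (q%:R ^+ j - 1)) / (q%:R ^+ j.+1 - 1) * q%:R ^- m)%:E <=
   haar2 (\bigcup_w delta_level_set w))%E.
Proof.
pose a : R := (1 - q%:R^-1) * ((1 - q%:R^-1 ^+ j) * q%:R^-1 ^+ m).
pose r : R := q%:R^-1 ^+ j.+1.
have q1 : 1 < q%:R :> R by rewrite ltr1n residue_card_gt1.
have q0 : 0 < q%:R :> R by apply: lt_trans q1.
have r0 : 0 <= r by rewrite exprn_ge0 // invr_ge0 ltW.
have r1 : r < 1 by rewrite exprn_ilt1 // ?invr_ge0 ?ltW // invf_lt1.
have a0 : 0 <= a.
  by rewrite !mulr_ge0 ?subr_ge0 ?exprn_ge0 ?exprn_ile1 ?invr_ge0 ?ler0n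
    ?residue_card_inv_le1.
rewrite measure_semi_bigcup; first last.
- exact: bigcup_measurable (fun w _ => measurable_delta_level_set w).
- by move=> u v _ _ [ab [abu abv]]; apply: delta_level_unique abu abv.
- exact: measurable_delta_level_set.
apply: (@le_trans _ _ (a / (1 - r))%:E).
  rewrite lee_fin le_eqVlt; apply/orP; left; apply/eqP.
  rewrite /a /r !exprVn exprS.
  have qj1 : q%:R * q%:R ^+ j - 1 != 0 :> R.
    by rewrite subr_eq0 gt_eqF // -exprS exprn_egt1.
  by field; rewrite qj1 !expf_neq0 ?gt_eqF.
rewrite -eseries_geometric ?ger0_norm //.
apply: lee_nneseries => [w _ _|w _]; last exact: haar2_delta_level_set_ge.
by rewrite lee_fin mulr_ge0 ?exprn_ge0.
Qed.

End delta_distribution.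

Theorem theorem3p5 (R : realType) (W : dvrType) (q : nat)
    (Wcomplete : adic_complete W)
    (Wq : ([set: residue_field W] #= `I_q)%card)
    (mu : probability (borel_dvr W) R) (mu_haar : is_haar mu)
    (d : nat) (d_ge1 : (1 <= d)%N)
    (disp : measure_display) (Omega : measurableType disp)
    (P : probability Omega R)
    (AB : {RV P >-> (d.-tuple (borel_dvr W) * d.-tuple (borel_dvr W))%type})
    (AB_haar : forall E, measurable E ->
      distribution P AB E =
        (power_probability mu d \x power_probability mu d)%E E)
    (j m : nat) (j_lt_d : (j < d)%N) :
  ((((q%:R - 1) * (q%:R ^+ j - 1)) / (q%:R ^+ j.+1 - 1) * q%:R ^- m)%:E <=
   P [set w | (m%:R%:E <=
      subresultant_delta R d j
        (@monic_of W d (AB w).1) (@monic_of W d (AB w).2))%E])%E.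
Proof.
have [D D_digits] := ex_digit_system Wq.
set E := [set w | _].
have -> : P E = distribution P AB (\bigcup_w delta_level_set j m w).
  congr (P _); apply/seteqP; split=> w; rewrite /E /= subresultant_deltaE.
    by move=> /delta_ge_level[l lE]; exists l.
  by move=> [l _ lE]; apply/delta_ge_level; exists l.
rewrite AB_haar; first exact: (haar2_delta_ge D_digits).
apply: bigcup_measurable => w _.
exact: (measurable_delta_level_set D_digits mu_haar).
Qed.
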